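(* Let $F_{\ell}=\bigcup_{i=1}^{\ell} P_{k_i}$ be a linear forest with $\ell\geq 1$, $k_1\geq \cdots \geq k_{\ell}\geq 2$, and $p=\sum_{i=1}^{\ell}\lfloor k_i/2\rfloor-1\geq 1$. If $G$ is an $F_\ell$-free bipartite graph of order $n$, with $n$ sufficiently large compared to $p$, then $\lambda(G)\leq\sqrt{p(n-p)}$, with equality if and only if $G=K_{p,n-p}$.
   Context: Graphs are finite, simple, undirected. $P_k$ is the path on $k$ vertices; a linear forest is a vertex-disjoint union of paths. $G$ is $F_\ell$-free if it contains no subgraph isomorphic to $F_\ell$. $\lambda(G)$ denotes the spectral radius (largest eigenvalue) of the adjacency matrix of $G$. *)

(* Defs.v *)
From HB Require Import structures.
From mathcomp Require Import all_boot all_order all_algebra.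
From mathcomp Require Import complex polyrcf boolp classical_sets reals.

Set Implicit Arguments.
Unset Strict Implicit.
Unset Printing Implicit Defensive.

Import Order.TTheory GRing.Theory Num.Theory.
Local Open Scope ring_scope.

Record sgraph := SGraph {
  vertex :> finType;
  adj : rel vertex;
  adj_sym : symmetric adj;
  adj_irr : irreflexive adj
}.

Arguments adj {s} x y : rename.

(* Subgraphs are not required to be induced. *)
Definition contains_subgraph (G F : sgraph) : Prop :=
  exists f : F -> G, injective f /\ forall x y : F, adj x y -> adj (f x) (f y).

Definition free_of (F G : sgraph) : Prop := ~ contains_subgraph G F.

Definition isomorphic (G H : sgraph) : Prop :=
  exists f : G -> H, bijective f /\ forall x y : G, adj (f x) (f y) = adj x y.

Definition bipartite (G : sgraph) : Prop :=
  exists c : G -> bool, forall x y : G, adj x y -> c x != c y.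

Section PathGraph.
Variable k : nat.

Definition path_adj (i j : 'I_k) : bool := (i.+1 == j) || (j.+1 == i).

Fact path_adj_sym : symmetric path_adj.
Proof. by move=> i j; rewrite /path_adj orbC. Qed.

Fact path_adj_irr : irreflexive path_adj.
Proof. by move=> i; rewrite /path_adj orbb eqn_leq ltnn. Qed.

Definition path_graph : sgraph := SGraph path_adj_sym path_adj_irr.
End PathGraph.

Section DisjointUnion.
Variables (I : finType) (G : I -> sgraph).

Definition dunion_adj (x y : {i : I & G i}) : bool :=
  (tag x == tag y) && adj (tagged x) (tagged_as x y).

Fact dunion_adj_sym : symmetric dunion_adj.
Proof.
move=> [i x] [j y]; rewrite /dunion_adj /=.
have [eqij|//] := eqVneq i j.
by case: j / eqij y => y; rewrite !tagged_asE adj_sym.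
Qed.

Fact dunion_adj_irr : irreflexive dunion_adj.
Proof. by move=> [i x]; rewrite /dunion_adj tagged_asE adj_irr andbF. Qed.

Definition dunion : sgraph := SGraph dunion_adj_sym dunion_adj_irr.
End DisjointUnion.

Definition linear_forest (l : nat) (k : 'I_l -> nat) : sgraph :=
  dunion (fun i => path_graph (k i)).

Section CompleteBipartite.
Variables a b : nat.

Definition complete_bipartite_adj (x y : 'I_a + 'I_b) : bool :=
  match x, y with
  | inl _, inr _ | inr _, inl _ => true
  | _, _ => false
  end.

Fact complete_bipartite_adj_sym : symmetric complete_bipartite_adj.
Proof. by move=> [x|x] [y|y]. Qed.

Fact complete_bipartite_adj_irr : irreflexive complete_bipartite_adj.
Proof. by move=> [x|x]. Qed.

Definition complete_bipartite : sgraph :=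
  SGraph complete_bipartite_adj_sym complete_bipartite_adj_irr.
End CompleteBipartite.

Section SpectralRadius.
Variable R : realType.

Definition adjacency_mx (G : sgraph) : 'M[R]_#|G| :=
  \matrix_(i, j) (adj (enum_val i) (enum_val j) : nat)%:R.

(* The set of eigenvalues is finite, and nonempty when G has a vertex, so this
   supremum is the largest eigenvalue: see [spectral_radius_max]. *)
Definition spectral_radius (G : sgraph) : R :=
  sup [set a : R | eigenvalue (adjacency_mx G) a]%classic.

Lemma adjacency_mx_sym (G : sgraph) : (adjacency_mx G)^T = adjacency_mx G.
Proof. by apply/matrixP=> i j; rewrite !mxE adj_sym. Qed.

Lemma sym_mx_eigenvalue n (A : 'M[R]_n) : (0 < n)%N -> A^T = A ->
  exists a, eigenvalue A a.
Proof.
move=> n_gt0 Asym; pose B := map_mx (real_complex R) A.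
have [c] : exists c, root (char_poly B) c.
  by apply: closed_rootP; rewrite size_char_poly eqSS -lt0n.
rewrite -eigenvalue_root_char => /eigenvalueP[v vB v_neq0].
pose w := (map_mx Num.conj v)^T.
have Bw : B *m w = c^* *: w.
  rewrite -[B]trmxK -trmx_mul /B matrix.map_trmx Asym -/B.
  rewrite /w -linearZ /=; congr (_^T).
  have -> : B = map_mx Num.conj B.
    by apply/matrixP=> i j; rewrite !mxE /= conj_Creal// complex_real.
  by rewrite -map_mxM vB map_mxZ.
have vw_neq0 : (v *m w) 0 0 != 0.
  rewrite mxE psumr_eq0 => [|i _]; last by rewrite !mxE mul_conjC_ge0.
  apply: contraNN v_neq0 => /allP h; apply/eqP/rowP=> i; rewrite mxE.
  have := h i (mem_index_enum _); rewrite !mxE/= mul_conjC_eq0.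
  by move/eqP.
have c_real : c \is Num.real.
  apply/CrealP.
  have : c^* *: (v *m w) = c *: (v *m w).
    by rewrite scalemxAr -Bw mulmxA vB -scalemxAl.
  by move/matrixP/(_ 0 0); rewrite !mxE => /(mulIf _); apply; rewrite mxE in vw_neq0.
exists (complex.Re c).
have : eigenvalue B c by apply/eigenvalueP; exists v.
rewrite !eigenvalue_root_char -(RRe_real c_real) /B -map_char_poly.
by rewrite fmorph_root.
Qed.

Lemma spectral_radius_max (G : sgraph) : (0 < #|G|)%N ->
  eigenvalue (adjacency_mx G) (spectral_radius G) /\
  forall a, eigenvalue (adjacency_mx G) a -> a <= spectral_radius G.
Proof.
move=> G_gt0; set A := adjacency_mx G.
have [a0 Aa0] := sym_mx_eigenvalue G_gt0 (adjacency_mx_sym G).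
have p_neq0 : char_poly A != 0 by exact/monic_neq0/char_poly_monic.
have rootsA a : eigenvalue A a = (a \in rootsR (char_poly A)).
  rewrite eigenvalue_root_char.
  by have := roots_on_rootsR p_neq0 a; rewrite in_itv /= => <-.
have [m Am m_max] : exists2 m, eigenvalue A m &
    forall a, eigenvalue A a -> a <= m.
  suff [m ms m_max] : exists2 m, m \in rootsR (char_poly A) &
      {in rootsR (char_poly A), forall a, a <= m}.
    by exists m => [|a]; rewrite rootsA // => /m_max.
  move: Aa0; rewrite -/A rootsA; elim: (rootsR _) a0 => // x s IHs _ _.
  case: s => [|y s] in IHs *.
    by exists x => [|a]; rewrite inE // => /eqP->.
  have [m ms m_max] := IHs y (mem_head _ _).
  exists (Num.max x m) => [|a]; rewrite inE.
    by case: (leP x m); rewrite ?eqxx ?ms ?orbT.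
  by rewrite le_max => /predU1P[->|/m_max->]; rewrite ?lexx ?orbT.
suff -> : spectral_radius G = m by [].
apply/le_anti/andP; split; first by apply: ge_sup => //; exists m.
by apply: ub_le_sup => //; exists m.
Qed.
End SpectralRadius.

(* Main.v *)
(** The absolute value of an eigenvector for [lam] is a function [g >= 0] with
    [lam * g <= A g]; normalise its maximum to 1 and assume
    [lam ^ 2 >= p (n - p)]. Being free of [F] forbids long paths, so all
    bipartite edge counts are linear in the number of vertices; it also forbids
    a vertex [x] outside a [p]-set [T] from having two neighbours among the
    common neighbours of [T], once these are numerous. Hence [lam ^ 2 * g v],
    which is at most the [g]-weighted number of walks of length two from [v],
    forces the vertices where [g] is not tiny to have linear degree and so to
    be boundedly many; all but boundedly many vertices see at most [p] of them.
    Walks from a maximum of [g] then produce a [p]-set [T] on which [g] is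
    nearly 1 and which is joined to nearly every vertex. Counting weighted walks
    of length two between vertices of [T], each vertex outside [T] that is not
    a common neighbour of [T] costs more than it brings in, so there are none
    and the graph is [K_{p,n-p}]. *)

Require Import Defs.
From mathcomp Require Import all_boot all_order all_algebra.
From mathcomp Require Import reals.
From mathcomp Require Import zify lra.

Set Implicit Arguments.
Unset Strict Implicit.
Unset Printing Implicit Defensive.

Import Order.TTheory GRing.Theory Num.Theory.

(** * Embedding linear forests *)

Lemma forest_embedding (G : sgraph) (l : nat) (k : 'I_l -> nat)
    (f : 'I_l -> nat -> G) :
  (forall i i' j j', j < k i -> j' < k i' -> f i j = f i' j' ->
     i = i' /\ j = j') ->
  (forall i j, j.+1 < k i -> adj (f i j) (f i j.+1)) ->
  contains_subgraph G (linear_forest k).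
Proof.
move=> f_inj f_adj.
exists (fun x : linear_forest k => f (tag x) (val (tagged x))); split.
  move=> [i j] [i' j'] /= /f_inj[] // eq_i; case: i' / eq_i j' => j' eq_j.
  by congr (Tagged _ _); apply: val_inj.
move=> [i j] [i' j'] /andP[/eqP /= eq_i]; case: i' / eq_i j' => j'.
rewrite tagged_asE /= => /orP[]/eqP e.
  by rewrite -e; apply: f_adj; rewrite e.
by rewrite adj_sym -e; apply: f_adj; rewrite e.
Qed.

(** Start of block [i] when blocks of lengths [a] are laid end to end. *)
Definition offset (l : nat) (a : 'I_l -> nat) (i : 'I_l) : nat :=
  \sum_(j < l | j < i) a j.

Lemma offset_lt (l : nat) (a : 'I_l -> nat) (i i' : 'I_l) :
  i < i' -> offset a i + a i <= offset a i'.
Proof.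
move=> lt_i; rewrite /offset [leqRHS](bigD1 i) //= addnC leq_add2l.
rewrite [leqRHS]big_mkcond [leqLHS]big_mkcond /=; apply: leq_sum => j _.
case: ltnP => // lt_j; rewrite (ltn_trans lt_j lt_i) /=.
by rewrite -val_eqE /= ltn_eqF.
Qed.

Lemma offset_le_sum (l : nat) (a : 'I_l -> nat) (i : 'I_l) :
  offset a i + a i <= \sum_(j < l) a j.
Proof.
rewrite [leqRHS](bigD1 i) //= addnC leq_add2l /offset.
rewrite [leqRHS]big_mkcond [leqLHS]big_mkcond /=; apply: leq_sum => j _.
by case: ltnP => // lt_j; rewrite -val_eqE /= ltn_eqF.
Qed.

Lemma offset_inj (l : nat) (a : 'I_l -> nat) (i i' : 'I_l) (m m' : nat) :
  m < a i -> m' < a i' -> offset a i + m = offset a i' + m' ->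
  i = i' /\ m = m'.
Proof.
move=> mi mi' e; case: (ltngtP i i') => [lt|lt|/val_inj eq_i].
- by have := offset_lt a lt; lia.
- by have := offset_lt a lt; lia.
- by split=> //; move: e; rewrite eq_i; lia.
Qed.

(** Cut the path into consecutive blocks of [k i] vertices and drop the edges between blocks. *)
Lemma path_contains_forest (G : sgraph) (l : nat) (k : 'I_l -> nat)
    (x : G) (s : seq G) :
  uniq (x :: s) -> path adj x s -> \sum_(i < l) k i <= (size s).+1 ->
  contains_subgraph G (linear_forest k).
Proof.
move=> s_uniq s_path s_size.
have bnd i j : j < k i -> offset k i + j < size (x :: s).
  move=> ji; apply: leq_trans (leq_trans (offset_le_sum k i) s_size).
  by rewrite ltn_add2l.
apply: (@forest_embedding _ _ _ (fun i j => nth x (x :: s) (offset k i + j))).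
  move=> i i' j j' ji ji' /eqP; rewrite nth_uniq ?bnd // => /eqP.
  exact: offset_inj.
move=> i j ji; have := bnd _ _ ji; rewrite addnS /= => lt_s.
by have /pathP-> := s_path.
Qed.

(* [sm] hosts the odd positions of the paths (a minimum vertex cover) and [bg]
   the even ones; the first vertex of [sm] is only ever asked for its
   adjacency to the first two vertices of [bg]. *)
Lemma cover_contains_forest (G : sgraph) (l : nat) (k : 'I_l -> nat)
    (x : G) (sm bg : seq G) :
  (forall i, 2 <= k i) ->
  uniq (sm ++ bg) ->
  \sum_(i < l) k i %/ 2 <= size sm ->
  \sum_(i < l) (k i %/ 2).+1 <= size bg ->
  (forall a b, a < size sm -> b < size bg -> (a == 0) ==> (b < 2) ->
     adj (nth x sm a) (nth x bg b)) ->
  contains_subgraph G (linear_forest k).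
Proof.
move=> k2 s_uniq sm_size bg_size s_adj.
have sm_bnd i j : j < k i -> odd j -> offset (fun i => k i %/ 2) i + j %/ 2 < size sm.
  move=> ji oj; apply: leq_trans (leq_trans (offset_le_sum _ i) sm_size).
  by rewrite ltn_add2l; lia.
(* The even positions number half of [k i] rounded up; a block of [(k i %/ 2).+1] holds them in
   either parity. *)
have bg_bnd i j : j < k i -> offset (fun i => (k i %/ 2).+1) i + j %/ 2 < size bg.
  move=> ji; apply: leq_trans (leq_trans (offset_le_sum _ i) bg_size).
  by rewrite ltn_add2l; lia.
move: s_uniq; rewrite cat_uniq => /and3P[sm_uniq /hasPn disj bg_uniq].
apply: (@forest_embedding _ _ _ (fun i j =>
  if odd j then nth x sm (offset (fun i => k i %/ 2) i + j %/ 2)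
  else nth x bg (offset (fun i => (k i %/ 2).+1) i + j %/ 2))).
  move=> i i' j j' ji ji'; case: ifP => oj; case: ifP => oj' e.
  - move/eqP: e; rewrite nth_uniq ?sm_bnd // => /eqP e.
    have [||-> ee] := offset_inj _ _ e; [lia|lia|split => //; lia].
  - by have /disj := mem_nth x (bg_bnd _ _ ji'); rewrite -e mem_nth ?sm_bnd.
  - by have /disj := mem_nth x (bg_bnd _ _ ji); rewrite e mem_nth ?sm_bnd.
  - move/eqP: e; rewrite nth_uniq ?bg_bnd // => /eqP e.
    have [||-> ee] := offset_inj _ _ e; [lia|lia|split => //; lia].
(* Every path uses a vertex of [sm], so index 0 of [sm] falls to the first path, at position 1; its
   neighbours there have indices 0 and 1 in [bg]. *)
have off0 i j : 0 < j -> offset (fun i => k i %/ 2) i + j %/ 2 = 0 ->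
    offset (fun i => (k i %/ 2).+1) i = 0.
  move=> j0 e; have i0 : i = 0 :> nat.
    apply/eqP; rewrite -leqn0 leqNgt; apply/negP => i_gt0.
    pose i0 : 'I_l := Ordinal (ltn_trans i_gt0 (ltn_ord i)).
    have := @offset_lt _ (fun i => k i %/ 2) i0 i i_gt0.
    by have := k2 i0; lia.
  by rewrite /offset big1 // => j'; rewrite i0.
move=> i j ji /=; have ji' := ltnW ji.
have := off0 i j.+1; case: ifP => oj /=.
  have := off0 i j => o0 _.
  apply: s_adj; [exact: sm_bnd|exact: bg_bnd|].
  apply/implyP => /eqP e; rewrite o0 //; lia.
move=> o0; rewrite adj_sym.
apply: s_adj; [by apply: sm_bnd; rewrite //= oj|exact: bg_bnd|].
apply/implyP => /eqP e; rewrite o0 //; lia.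
Qed.

(** * Edge counts and common neighbourhoods in forest-free graphs *)

Section Neighbourhoods.
Variable G : sgraph.

Definition nbr (v : G) : {set G} := [set w | adj v w].

Definition cnbr (T : {set G}) : {set G} := [set w | T \subset nbr w].

(** Counts ordered pairs: an edge inside [A :&: B] counts twice. *)
Definition edges (A B : {set G}) : nat := \sum_(a in A) #|nbr a :&: B|.

Lemma nbr_sym (v w : G) : (v \in nbr w) = (w \in nbr v).
Proof. by rewrite !inE adj_sym. Qed.

Lemma edgesC (A B : {set G}) : edges A B = edges B A.
Proof.
have e (C D : {set G}) : edges C D = \sum_(a in C) \sum_(b in D) adj a b.
  apply: eq_bigr => a _; rewrite -sum1_card big_mkcond [RHS]big_mkcond /=.
  by apply: eq_bigr => b _; rewrite !inE; case: adj; case: (b \in D).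
rewrite !e exchange_big; apply: eq_bigr => a _; apply: eq_bigr => b _.
by rewrite adj_sym.
Qed.

Lemma edgesS (A A' B B' : {set G}) :
  A \subset A' -> B \subset B' -> edges A B <= edges A' B'.
Proof.
move=> sA sB; rewrite /edges [leqRHS]big_mkcond [leqLHS]big_mkcond /=.
apply: leq_sum => a _; case: ifP => // /(subsetP sA) ->.
by apply: subset_leq_card; apply: setIS.
Qed.

(** The endpoint has at least [m] neighbours in [V], and the fewer than [m] earlier vertices of the
    path cannot block them all. *)
Lemma greedy_path (m : nat) (V : {set G}) (x : G) :
  x \in V -> (forall v, v \in V -> m <= #|nbr v :&: V|) ->
  forall j, j <= m -> exists s : seq G,
    [/\ uniq (x :: s), path adj x s, size s = j & {subset x :: s <= V}].
Proof.
move=> xV degV; elim=> [_|j IHj j_lt].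
  by exists [::]; split => // y; rewrite inE => /eqP->.
have [s [s_uniq s_path s_size sV]] := IHj (ltnW j_lt).
have lastV : last x s \in V by apply: sV; apply: mem_last.
have /subsetPn[y] : ~~ (nbr (last x s) :&: V \subset belast x s).
  apply/negP => /subset_leq_card /leq_trans/(_ (card_size _)).
  by rewrite size_belast s_size => /(leq_trans (degV _ lastV)); lia.
rewrite !inE => /andP[y_adj yV] y_nin; exists (rcons s y); split.
- rewrite -rcons_cons rcons_uniq s_uniq andbT lastI mem_rcons inE negb_or y_nin.
  by rewrite andbT; apply: contraTneq y_adj => ->; rewrite adj_irr.
- by rewrite rcons_path s_path.
- by rewrite size_rcons s_size.
- by move=> z; rewrite -rcons_cons mem_rcons inE => /predU1P[->|/sV].
Qed.

(** Degeneracy: without a path of [m] edges, every nonempty set has a vertex with fewer than [m]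
    neighbours in it. Deleting that vertex loses fewer than [2 * m] ordered pairs, and induction on
    the size applies, finally to [A :|: B]. *)
Lemma edges_le (m : nat) :
  (forall (x : G) (s : seq G), uniq (x :: s) -> path adj x s -> size s < m) ->
  forall A B, edges A B <= (2 * m) * (#|A| + #|B|).
Proof.
move=> no_path.
suff self (V : {set G}) : edges V V <= 2 * m * #|V|.
  move=> A B; apply: leq_trans (edgesS (subsetUl A B) (subsetUr A B)) _.
  by apply: leq_trans (self _) _; rewrite leq_mul2l cardsU leq_subr orbT.
move: {2}#|V| (erefl #|V|) => j; elim: j V => [|j IHj] V cardV.
  by rewrite /edges (cards0_eq cardV) big_set0.
have [v vV dv] : exists2 v, v \in V & #|nbr v :&: V| < m.
  have /card_gt0P[x xV] : 0 < #|V| by rewrite cardV.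
  case: (pickP (fun v => (v \in V) && (#|nbr v :&: V| < m))).
    by move=> v /andP[]; exists v.
  move=> none; have [v vV|s [s_uniq s_path s_size _]] :=
      @greedy_path m V x xV _ m (leqnn m).
    by rewrite leqNgt; have := none v; rewrite vV /= => ->.
  by have := no_path _ _ s_uniq s_path; rewrite s_size ltnn.
have cardV' : #|V :\ v| = j by move: cardV; rewrite (cardsD1 v) vV => -[].
have step W : edges V W = #|nbr v :&: W| + edges (V :\ v) W.
  by rewrite /edges (big_setD1 v vV).
rewrite step edgesC step cardV.
have := IHj _ cardV'; rewrite cardV'.
have : #|nbr v :&: (V :\ v)| <= #|nbr v :&: V|.
  by apply/subset_leq_card/setIS/subD1set.
by move: dv; nia.
Qed.

End Neighbourhoods.

Lemma free_edges_le (G : sgraph) (p l : nat) (k : 'I_l -> nat) :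
  (forall i, 2 <= k i) -> \sum_(i < l) k i %/ 2 = p.+1 ->
  free_of (linear_forest k) G ->
  forall A B : {set G}, edges A B <= 6 * p.+1 * (#|A| + #|B|).
Proof.
move=> k2 sum_k freeG A B.
(* For [2 <= k i], the ratio of [k i] to [k i %/ 2] is at most 3, attained at [k i = 3]. *)
have sum_le : \sum_(i < l) k i <= 3 * p.+1.
  by rewrite -sum_k big_distrr /=; apply: leq_sum => i _; have := k2 i; lia.
have -> : 6 * p.+1 = 2 * (3 * p.+1) by lia.
apply: edges_le => x s s_uniq s_path; rewrite ltnNge; apply/negP => s_size.
apply: freeG; apply: path_contains_forest s_uniq s_path _.
by apply: leq_trans sum_le _; apply: leq_trans s_size _.
Qed.

(** Two neighbours [w0], [w1] of [x] in [cnbr T] would make [x] and [T] the [p.+1] cover vertices of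
    a copy of the forest: [x] comes first and needs only [w0] and [w1]. The other side takes
    [p.+1 + l] vertices, at most [2 * p.+1]. *)
Lemma free_cnbr (G : sgraph) (p l : nat) (k : 'I_l -> nat) :
  (forall i, 2 <= k i) -> \sum_(i < l) k i %/ 2 = p.+1 ->
  free_of (linear_forest k) G ->
  forall (T : {set G}) (x : G), #|T| = p -> x \notin T -> x \notin cnbr T ->
    2 * p.+1 <= #|cnbr T| -> #|nbr x :&: cnbr T| <= 1.
Proof.
move=> k2 sum_k freeG T x cardT xT xW cardW; rewrite leqNgt; apply/negP.
case/card_gt1P => w0 [w1 [w0x w1x w01]]; apply: freeG.
move: w0x w1x; rewrite !inE => /andP[x_w0 w0W] /andP[x_w1 w1W].
have [{}w0W {}w1W] : w0 \in cnbr T /\ w1 \in cnbr T by rewrite !inE.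
pose U := cnbr T :\ w0 :\ w1.
have w0U : w0 \notin enum U by rewrite mem_enum !inE eqxx andbF.
have w1U : w1 \notin enum U by rewrite mem_enum !inE eqxx.
have TW t w : t \in T -> w \in cnbr T -> adj t w.
  by rewrite [w \in _]inE => tT /subsetP/(_ _ tT); rewrite inE adj_sym.
have sub : {subset [:: w0, w1 & enum U] <= cnbr T}.
  move=> w; rewrite !in_cons mem_enum => /or3P[/eqP->|/eqP->|] //.
  by rewrite !in_setD1 => /and3P[].
apply: (@cover_contains_forest _ _ _ x (x :: enum T) [:: w0, w1 & enum U]) => //.
- rewrite cat_uniq cons_uniq mem_enum xT enum_uniq; apply/and3P; split => //;
    last by rewrite /= in_cons negb_or w01 w0U w1U enum_uniq.
  apply/hasPn => w /sub wW; rewrite inE negb_or; apply/andP; split.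
    by apply: contraNneq xW => <-.
  by rewrite mem_enum; apply/negP => wT; have := TW _ _ wT wW; rewrite adj_irr.
- by rewrite sum_k /= -cardE cardT.
- have : #|U| + 2 = #|cnbr T|.
    rewrite (cardsD1 w0 (cnbr T)) w0W (cardsD1 w1 (cnbr T :\ w0)) /U.
    by rewrite in_setD1 w1W eq_sym w01 /=; lia.
  have -> : \sum_(i < l) (k i %/ 2).+1 = p.+1 + l.
    rewrite -sum_k; under eq_bigr do rewrite -addn1.
    by rewrite big_split /= sum1_card card_ord.
  have : l <= p.+1.
    rewrite -sum_k -[leqLHS]card_ord -sum1_card; apply: leq_sum => i _.
    by have := k2 i; lia.
  by rewrite /= -cardE; lia.
- move=> [|a] b /= a_lt b_lt.
    by case: b b_lt => [|[|b]] //=.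
  by move=> _; apply: TW; [rewrite -mem_enum mem_nth | apply/sub/mem_nth].
Qed.

Local Open Scope ring_scope.

(** * Weighted walks *)

Lemma subset_of_card (T : finType) (A : {set T}) (m : nat) :
  (m <= #|A|)%N -> exists2 B : {set T}, B \subset A & #|B| = m.
Proof.
move=> mA; exists [set x in take m (enum A)].
  by apply/subsetP => x; rewrite inE => /mem_take; rewrite mem_enum.
rewrite cardsE (card_uniqP _) ?take_uniq ?enum_uniq // size_takel //.
by rewrite -cardE.
Qed.

(** * Level sets of a nonnegative subsolution *)

Section Subsolution.
Variables (R : realType) (G : sgraph) (c : G -> bool) (p K : nat).
Hypothesis cP : forall x y : G, adj x y -> c x != c y.
Hypothesis p_gt0 : (0 < p)%N.
Hypothesis K_gt0 : (0 < K)%N.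
Hypothesis edges_lin :
  forall A B : {set G}, (edges A B <= K * (#|A| + #|B|))%N.
Hypothesis edges_all : forall A B : {set G}, (edges A B <= K * #|G|)%N.
Hypothesis cnbr_rigid :
  forall (T : {set G}) (x : G), #|T| = p -> x \notin T -> x \notin cnbr T ->
    (2 * p.+1 <= #|cnbr T|)%N -> (#|nbr x :&: cnbr T| <= 1)%N.
Variables (lam : R) (g : G -> R).
Hypothesis lam_gt0 : 0 < lam.
Hypothesis g_ge0 : forall v, 0 <= g v.
Hypothesis g_le1 : forall v, g v <= 1.
Hypothesis g_sub : forall v, lam * g v <= \sum_(w in nbr v) g w.

Local Notation n := #|G|.
Local Notation nR := (#|G|%:R : R).
Local Notation P := (p%:R : R).
Local Notation Kr := (K%:R : R).
Local Notation card A := (#|A|%:R : R).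

Definition level (e : R) : {set G} := [set v | e <= g v].

(** For [A = nbr v] and [B = setT] this is the square of the adjacency operator applied to [g],
    evaluated at [v]. *)
Definition walks (A B : {set G}) : R :=
  \sum_(y in A) \sum_(x in nbr y :&: B) g x.

Lemma walks_le (A B : {set G}) (e : R) :
  (forall x, x \in B -> g x <= e) -> walks A B <= e * (edges A B)%:R.
Proof.
move=> ge; rewrite /edges natr_sum mulr_sumr; apply: ler_sum => y _.
rewrite mulr_natr -sumr_const; apply: ler_sum => x; rewrite inE => /andP[_].
exact: ge.
Qed.

Lemma walksID (A B : {set G}) : walks A setT = walks A B + walks A (~: B).
Proof.
rewrite -big_split /=; apply: eq_bigr => y _.
by rewrite setIT (big_setID B) /= setDE.
Qed.

Lemma subsolution_walks (v : G) : lam ^+ 2 * g v <= walks (nbr v) setT.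
Proof.
rewrite expr2 -mulrA; apply: (le_trans (ler_wpM2l (ltW lam_gt0) (g_sub v))).
rewrite mulr_sumr; apply: ler_sum => y _; rewrite setIT; exact: g_sub.
Qed.

Lemma walks_level (A : {set G}) (e : R) : 0 <= e ->
  walks A setT <= walks A (level e) + e * (Kr * nR).
Proof.
move=> e_ge0; rewrite (walksID _ (level e)) lerD2l.
apply: (@le_trans _ _ (e * (edges A (~: level e))%:R)).
  by apply: walks_le => x; rewrite !inE -ltNge => /ltW.
by apply: ler_wpM2l => //; rewrite -natrM ler_nat edges_all.
Qed.

(** Summing [g_sub] over the level set bounds the left side by the edges leaving that set. Once
    [lam] is at least of order sqrt n, level sets have O(sqrt n) vertices. *)
Lemma level_card (e : R) : lam * e * card (level e) <= Kr * nR.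
Proof.
apply: (@le_trans _ _ (edges (level e) [set: G])%:R); last first.
  by rewrite -natrM ler_nat edges_all.
rewrite mulr_natr -sumr_const /edges natr_sum; apply: ler_sum => v.
rewrite inE => ev; apply: (le_trans (ler_wpM2l (ltW lam_gt0) ev)).
apply: le_trans (g_sub v) _; rewrite setIT -[leRHS]mulr1 mulr_natl.
by rewrite -sumr_const; apply: ler_sum.
Qed.

(** Two-step walks from [v] weigh at least [e * nR / 2]. Those ending below level [eta] bring at
    most a quarter of this; the others are at most the edges between [nbr v] and [level eta], where
    the size of [level eta] accounts for another quarter. *)
Lemma level_deg (e eta : R) (v : G) :
  0 < e -> 0 < eta -> nR <= 2 * lam ^+ 2 -> 8 * (eta * Kr) <= e ->
  8 * (Kr * card (level eta)) <= e * nR -> e <= g v ->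
  e * nR <= 4 * (Kr * card (nbr v)).
Proof.
move=> e_gt0 eta_gt0 n_le etaK levelK ev.
have w1 := subsolution_walks v.
have w2 := walks_level (nbr v) (ltW eta_gt0).
have w3 : walks (nbr v) (level eta) <= Kr * (card (nbr v) + card (level eta)).
  apply: (@le_trans _ _ (edges (nbr v) (level eta))%:R).
    by rewrite -[leRHS]mul1r; apply: walks_le.
  by rewrite -natrD -natrM ler_nat edges_lin.
have w4 := ler_wpM2l (ltW e_gt0) n_le.
have w4' := ler_wpM2l (sqr_ge0 lam) ev.
have w5 := ler_wpM2r (ler0n R n) etaK.
by move: w1 w2 w3 w4 w4' w5 levelK; lra.
Qed.

(** Linear degrees on the level set against a linear number of edges: its size is bounded
    independently of [n]. *)
Lemma level_card_bound (e : R) : 0 < e -> (0 < n)%N ->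
  (forall v, e <= g v -> e * nR <= 4 * (Kr * card (nbr v))) ->
  e * card (level e) <= 4 * Kr ^+ 2.
Proof.
move=> e_gt0 n_gt0 deg.
rewrite -(@ler_pM2r _ nR) ?ltr0n //.
apply: (@le_trans _ _ (4 * Kr * (edges (level e) [set: G])%:R)); last first.
  rewrite expr2 mulrA -!mulrA !ler_wpM2l // -natrM ler_nat.
  exact: edges_all.
rewrite mulrAC [leLHS]mulr_natr -sumr_const /edges natr_sum mulr_sumr.
by apply: ler_sum => v; rewrite inE => /deg; rewrite setIT mulrA.
Qed.

(** * Vertices with many neighbours in a small set *)

Definition rich (S : {set G}) : {set G} := [set y | (p < #|nbr y :&: S|)%N].

Lemma common_nbr_coloring (x y z : G) : adj y x -> adj y z -> c x = c z.
Proof. by move=> /cP + /cP; case: (c x); case: (c y); case: (c z). Qed.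

(** Sort the rich vertices by their trace [U] on [S]. If a class [F] had more than [2 * p.+1]
    members, then for [x] in [U] and a [p]-set [T] in [U :\ x], all of [F] would lie in
    [nbr x :&: cnbr T], against [cnbr_rigid]. *)
Lemma rich_card (S : {set G}) : (#|rich S| <= 2 ^ #|S| * (2 * p.+1))%N.
Proof.
rewrite -card_powerset -sum_nat_const -sum1_card.
rewrite (partition_big (fun y => nbr y :&: S) (mem (powerset S))) /=; last first.
  by move=> y _; rewrite inE subsetIr.
apply: leq_sum => U _; rewrite sum1dep_card.
set F := [set y | _]; rewrite leqNgt; apply/negP => cardF.
have /card_gt0P[y0 y0F] : (0 < #|F|)%N by apply: leq_trans cardF.
have FE y : y \in F -> nbr y :&: S = U by rewrite inE => /andP[_ /eqP].
have cardU : (p < #|U|)%N.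
  by rewrite -(FE _ y0F); move: y0F; rewrite !inE => /andP[].
have /card_gt0P[x xU] : (0 < #|U|)%N by apply: leq_trans cardU.
have adjF y z : y \in F -> z \in U -> adj y z.
  by move=> /FE <-; rewrite !inE => /andP[].
have : (p <= #|U :\ x|)%N by move: cardU; rewrite (cardsD1 x) xU.
case/subset_of_card => T sT cardT.
have sTU : T \subset U by apply: subset_trans sT (subD1set _ _).
have /card_gt0P[t tT] : (0 < #|T|)%N by rewrite cardT.
have FW : F \subset nbr x :&: cnbr T.
  apply/subsetP => y yF; rewrite inE nbr_sym inE adjF //= inE.
  by apply/subsetP => z /(subsetP sTU) zU; rewrite inE adjF.
have /(leq_trans cardF) cardFW := subset_leq_card FW.
have cardW := leq_trans cardFW (subset_leq_card (subsetIr _ _)).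
suff: (#|nbr x :&: cnbr T| <= 1)%N by lia.
apply: cnbr_rigid => //; last exact: ltnW.
  by apply/negP => /(subsetP sT); rewrite !inE eqxx.
(* [x] and [t] share the neighbour [y0], hence a colour, so they are not adjacent. *)
apply/negP; rewrite inE => /subsetP/(_ t tT); rewrite inE => /cP/eqP; apply.
by apply: (@common_nbr_coloring x y0); apply: adjF => //; apply: (subsetP sTU).
Qed.

Lemma walks_rich (A S : {set G}) (q : R) : 0 <= q ->
  (forall y, y \in A -> y \notin rich S -> \sum_(x in nbr y :&: S) g x <= q) ->
  walks A S <= q * card A + card (rich S) * card S.
Proof.
move=> q_ge0 qP.
have bnd y : \sum_(x in nbr y :&: S) g x <= card S.
  apply: (@le_trans _ _ (card (nbr y :&: S))).
    by rewrite -[leRHS]mulr1 mulr_natl -sumr_const; apply: ler_sum.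
  by rewrite ler_nat subset_leq_card // subsetIr.
rewrite /walks (big_setID (rich S)) /= addrC; apply: lerD.
  apply: (@le_trans _ _ (q * card (A :\: rich S))).
    rewrite mulr_natr -sumr_const; apply: ler_sum => y.
    by rewrite inE => /andP[yS yA]; apply: qP.
  by rewrite ler_wpM2l // ler_nat subset_leq_card // subsetDl.
apply: (@le_trans _ _ (card (A :&: rich S) * card S)).
  by rewrite mulr_natl -sumr_const; apply: ler_sum.
by rewrite ler_wpM2r // ler_nat subset_leq_card // subsetIr.
Qed.

Lemma not_rich (S : {set G}) (y : G) : y \notin rich S -> (#|nbr y :&: S| <= p)%N.
Proof. by rewrite inE -leqNgt. Qed.

(** Neighbours that are not rich bring at most [P] each, rich ones at most [b] in all. With
    [lam ^+ 2] close to [P * nR], a value of [g] near 1 thus forces a degree near [n]. *)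
Lemma walks_level_deg (e b : R) (v : G) : 0 <= e ->
  card (rich (level e)) * card (level e) <= b ->
  lam ^+ 2 * g v <= P * card (nbr v) + b + e * (Kr * nR).
Proof.
move=> e_ge0 bP; apply: le_trans (subsolution_walks v) _.
apply: le_trans (walks_level _ e_ge0) _; rewrite lerD2r.
apply: (@le_trans _ _ (P * card (nbr v) + card (rich (level e)) * card (level e))).
  apply: walks_rich => // y _ /not_rich; rewrite -(ler_nat R) => yp.
  apply: le_trans yp; rewrite -[leRHS]mulr1 mulr_natl -sumr_const.
  exact: ler_sum.
by rewrite lerD2l.
Qed.

(* Otherwise every neighbour of the maximum [u] outside [rich] would contribute
   at most [P - d] to the walks of length two from [u]. *)
Lemma exists_core (e d b : R) (u : G) : 0 <= e -> 0 < d -> d <= 1 -> g u = 1 ->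
  P * (nR - P) <= lam ^+ 2 ->
  card (rich (level e)) * card (level e) <= b ->
  P ^+ 2 + b + e * (Kr * nR) < d * nR ->
  exists y : G, exists T : {set G},
    [/\ T \subset nbr y, #|T| = p & forall t, t \in T -> 1 - d <= g t].
Proof.
move=> e_ge0 d_gt0 d_le1 gu lam_ge bP n_large.
have P_ge1 : 1 <= P by rewrite ler1n.
pose wt y := \sum_(x in nbr y :&: level e) g x.
have [y /andP[_ /andP[/not_rich y_poor wty]]|none] := pickP (fun y =>
    (y \in nbr u) && ((y \notin rich (level e)) && (P - d < wt y))); last first.
  have w1 := subsolution_walks u.
  have w2 := walks_level (nbr u) e_ge0.
  have w3 : walks (nbr u) (level e) <= (P - d) * card (nbr u) +
      card (rich (level e)) * card (level e).
    apply: walks_rich => [|y yu yr]; first by lra.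
    by have := none y; rewrite yu yr /= leNgt => ->.
  have w4 : (P - d) * card (nbr u) <= (P - d) * nR.
    by apply: ler_wpM2l; [lra | rewrite ler_nat max_card].
  by move: w1 w2 w3 w4 lam_ge bP n_large; rewrite gu; lra.
have wt_le (B : {set G}) : \sum_(x in B) g x <= card B.
  by rewrite -[leRHS]mulr1 mulr_natl -sumr_const; apply: ler_sum.
(* At most [p] weights, each at most 1, sum to more than [P - d]: there are exactly [p] of them,
   each above [1 - d]. *)
exists y, (nbr y :&: level e); split; first exact: subsetIl.
  apply/eqP; rewrite eqn_leq y_poor /= leqNgt; apply/negP.
  rewrite -(ler_nat R) -natr1 => y_lt.
  by have := wt_le (nbr y :&: level e); rewrite -/(wt y); lra.
move=> t tT; have := wty; rewrite /wt (big_setD1 t) //=.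
have := wt_le ((nbr y :&: level e) :\ t).
have : card ((nbr y :&: level e) :\ t) <= P - 1.
  have : (#|(nbr y :&: level e) :\ t|.+1 <= p)%N.
    by apply: leq_trans y_poor; rewrite [leqRHS](cardsD1 t) tT.
  by rewrite -(ler_nat R) -natr1; lra.
by lra.
Qed.

(** * Rigidity around a core *)

Lemma cnbr_card (T : {set G}) (d : R) : 0 <= d ->
  (forall t, t \in T -> nR - card (nbr t) <= d) ->
  card (~: cnbr T) <= card T * d.
Proof.
move=> d_ge0 dP.
have sub : ~: cnbr T \subset \bigcup_(t in T) ~: nbr t.
  apply/subsetP => w; rewrite !inE => /subsetPn[t tT tw].
  by apply/bigcupP; exists t => //; rewrite inE nbr_sym.
have le1 : (#|~: cnbr T| <= \sum_(t in T) #|~: nbr t|)%N.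
  apply: leq_trans (subset_leq_card sub) _.
  elim/big_rec2: _ => [|t m B _ le_m]; first by rewrite cards0.
  by apply: leq_trans (leq_card_setU _ _) _; rewrite leq_add2l.
apply: (@le_trans _ _ (\sum_(t in T) #|~: nbr t|)%N%:R); first by rewrite ler_nat.
rewrite natr_sum mulr_natl -sumr_const; apply: ler_sum => t tT.
by rewrite cardsCs setCK natrB ?max_card ?dP.
Qed.

(** [Y] is the colour class of [y0]; [T] lies in the other class, [Q] is the rest of that class, and
    [D] collects the vertices of [Y] missing some vertex of [T]. Weighing the two-step walks from
    [T] shows that [Q] and [D] are empty. *)
Lemma core_rigidity (T : {set G}) (y0 : G) (om : R) :
  T \subset nbr y0 -> #|T| = p -> 1 <= 2 * \sum_(t in T) g t ->
  card (~: cnbr T) <= om * nR -> (2 * p.+1 <= #|cnbr T|)%N ->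
  P * nR <= 2 * lam ^+ 2 -> 8 * (P + 2 * Kr) * (1 + Kr) * om <= 1 ->
  P * (nR - P) <= lam ^+ 2 ->
  lam ^+ 2 = P * (nR - P) /\ cnbr T = ~: T.
Proof.
move=> sTy cardT s_ge; set W := cnbr T => cardW W_large n_le om_le lam_ge.
set s := \sum_(t in T) g t in s_ge.
have P_ge1 : 1 <= P by rewrite ler1n.
have K_ge1 : 1 <= Kr by rewrite ler1n.
pose Y := [set v | c v == c y0]; pose Q := ~: Y :\: T; pose D := Y :\: W.
have n_gt0 : 0 < nR by rewrite ltr0n; apply/card_gt0P; exists y0.
have nbrX x : x \notin Y -> nbr x \subset Y.
  move=> xX; apply/subsetP => y; rewrite !inE in xX *.
  by move=> /cP; move: xX; case: (c x); case: (c y); case: (c y0).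
have nbrY y : y \in Y -> nbr y \subset ~: Y.
  move=> yY; apply/subsetP => x; rewrite !inE in yY *.
  by move=> /cP; move: yY; case: (c x); case: (c y); case: (c y0).
have sTX : T \subset ~: Y.
  by apply: subset_trans sTy (nbrY _ _); rewrite inE.
have TX t : t \in T -> t \notin Y by move/(subsetP sTX); rewrite inE.
have /card_gt0P[t0 t0T] : (0 < #|T|)%N by rewrite cardT.
have sWY : W \subset Y.
  apply/subsetP => w; rewrite inE => /subsetP/(_ _ t0T); rewrite nbr_sym => wt.
  exact: (subsetP (nbrX _ (TX _ t0T))).
have cardY : card Y = nR - P - card Q.
  have e1 : (#|Y| + #|~: Y| = n)%N by apply: cardsC.
  have e2 : (p + #|Q| = #|~: Y|)%N.
    by rewrite (cardsD _ T) (setIidPr sTX) -cardT subnKC // subset_leq_card.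
  by rewrite -e1 -e2 !natrD; lra.
have cardD : card D = card Y - card W.
  by rewrite /D (cardsD Y W) (setIidPr sWY) natrB // subset_leq_card.
have cardCW : card (~: W) = card Q + card D + P.
  by rewrite cardsCs setCK natrB ?max_card // cardD cardY; lra.
have nbrQ y : y \in Y -> nbr y :&: ~: T = nbr y :&: Q.
  move=> yY; apply/setP => x; rewrite !in_setI in_setD in_setC.
  by case xy: (x \in nbr y) => //=; rewrite (subsetP (nbrY _ yY)) ?andbT.
have Q_W x : x \in Q -> (#|nbr x :&: W| <= 1)%N.
  rewrite !inE => /andP[xT xX]; apply: cnbr_rigid => //.
  by apply/negP => /(subsetP sWY); rewrite inE (negPf xX).
have nbr_WD x : x \in Q -> nbr x :\: W = nbr x :&: D.
  rewrite in_setD in_setC => /andP[_ xX]; apply/setP => y.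
  rewrite !in_setD !in_setI; case xy: (y \in nbr x); rewrite ?andbF //=.
  by rewrite in_setD (subsetP (nbrX _ xX)).
have deg_Q x : x \in Q -> card (nbr x) <= 1 + card D.
  move=> xQ; rewrite nat1r ler_nat -(cardsID W (nbr x)) -add1n.
  apply: leq_add; first exact: Q_W.
  by rewrite nbr_WD // subset_leq_card // subsetIr.
(* A vertex of [Q] has at most one neighbour in [W], so its degree is at most [om * nR]; its
   two-step walks weigh at most [P + 2 * Kr] times that. The factor 2 comes from [n_le]. *)
pose m := 2 * (P + 2 * Kr) * om.
have g_Q x : x \in Q -> P * g x <= m.
  move=> xQ; have xX : x \notin Y by move: xQ; rewrite !inE => /andP[].
  have w1 := subsolution_walks x; have := walksID (nbr x) T => w2.
  have w3 : walks (nbr x) T <= P * card (nbr x).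
    rewrite mulr_natr -sumr_const; apply: ler_sum => y _.
    apply: (@le_trans _ _ (card (nbr y :&: T))).
      by rewrite -[leRHS]mulr1 mulr_natl -sumr_const; apply: ler_sum.
    by rewrite ler_nat -cardT subset_leq_card // subsetIr.
  have w4 : walks (nbr x) (~: T) <= Kr * (card (nbr x) + card Q).
    have -> : walks (nbr x) (~: T) = walks (nbr x) Q.
      by apply: eq_bigr => y /(subsetP (nbrX _ xX)) /nbrQ ->.
    apply: (@le_trans _ _ (edges (nbr x) Q)%:R).
      by rewrite -[leRHS]mul1r; apply: walks_le.
    by rewrite -natrD -natrM ler_nat edges_lin.
  have d_le : card (nbr x) <= om * nR.
    by have := deg_Q _ xQ; have := ler0n R #|Q|; lra.
  have q_le : card Q <= om * nR by have := ler0n R #|D|; lra.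
  rewrite -(ler_pM2r n_gt0) /m.
  have := ler_wpM2l (ler0n R p) d_le; have := ler_wpM2l (ler0n R K) d_le.
  have := ler_wpM2l (ler0n R K) q_le; have := ler_wpM2r (g_ge0 x) n_le.
  by move: w1 w2 w3 w4; lra.
have s_ge0 : 0 <= s by apply: sumr_ge0.
pose h y := \sum_(x in nbr y) g x.
(* The walks from all of [T] are regrouped by their middle vertex [y]. *)
have big_sum : lam ^+ 2 * s <= \sum_(y in Y) card (nbr y :&: T) * h y.
  rewrite mulr_sumr.
  have -> : \sum_(y in Y) card (nbr y :&: T) * h y =
            \sum_(t in T) \sum_(y in nbr t) h y.
    rewrite [RHS](exchange_big_dep (mem Y)) /=; last first.
      by move=> t y /TX/nbrX/subsetP; apply.
    apply: eq_bigr => y _; rewrite mulr_natl -sumr_const.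
    by apply: eq_bigl => t; rewrite inE andbC nbr_sym.
  apply: ler_sum => t _; apply: le_trans (subsolution_walks t) _.
  by apply: ler_sum => y _; rewrite setIT.
(* A vertex of [D] misses a vertex of [T], which costs a full [s]; an end in [Q] brings at most
   [P * g x], hence [m]. *)
have term y : y \in Y -> card (nbr y :&: T) * h y <=
    P * s - (y \in D)%:R * s + m * card (nbr y :&: Q).
  move=> yY; rewrite /h (big_setID T) /= setDE nbrQ // mulrDr.
  have h1 : \sum_(x in nbr y :&: T) g x <= s.
    rewrite /s [leRHS](big_setID (nbr y)) /= [T :&: _]setIC lerDl.
    exact: sumr_ge0.
  have h1_ge0 : 0 <= \sum_(x in nbr y :&: T) g x by apply: sumr_ge0.
  have h2_ge0 : 0 <= \sum_(x in nbr y :&: Q) g x by apply: sumr_ge0.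
  have dT : card (nbr y :&: T) <= P - (y \in D)%:R.
    case yD: (y \in D); rewrite ?subr0; last first.
      by rewrite ler_nat -cardT subset_leq_card // subsetIr.
    have : (#|nbr y :&: T| < p)%N.
      rewrite -cardT proper_card // properE subsetIr /=; apply/negP => sT.
      move: yD; rewrite in_setD inE.
      by rewrite (subset_trans sT (subsetIl _ _)).
    by rewrite -(ler_nat R) -natr1 /=; lra.
  have dT_ge0 : 0 <= card (nbr y :&: T) by [].
  apply: lerD.
    rewrite -mulrBl; apply: ler_pM => //.
  apply: (@le_trans _ _ (P * \sum_(x in nbr y :&: Q) g x)).
    apply: ler_wpM2r => //; apply: le_trans dT _.
    by rewrite gerBl.
  rewrite mulr_sumr mulr_natr -sumr_const; apply: ler_sum => x.
  by rewrite inE => /andP[_ /g_Q].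
have edgesYQ : \sum_(y in Y) card (nbr y :&: Q) <= card Q + Kr * (card Q + card D).
  have -> : \sum_(y in Y) card (nbr y :&: Q) = (edges Y Q)%:R by rewrite natr_sum.
  rewrite edgesC -natrD -natrM -natrD ler_nat.
  apply: leq_trans (leq_add (leqnn _) (edges_lin Q D)).
  rewrite -sum1_card -big_split /=; apply: leq_sum => x xQ.
  have xX : x \notin Y by move: xQ; rewrite !inE => /andP[].
  rewrite (setIidPl (nbrX _ xX)) -(cardsID W) leq_add ?Q_W //.
  by rewrite nbr_WD.
have m_ge0 : 0 <= m.
  rewrite /m; have : 0 <= om by rewrite -(pmulr_lge0 _ n_gt0); apply: le_trans cardW.
  by move=> ?; rewrite !mulr_ge0 // addr_ge0 ?mulr_ge0.
have total : lam ^+ 2 * s <= P * s * card Y - card D * s +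
    m * (card Q + Kr * (card Q + card D)).
  apply: le_trans big_sum _; apply: le_trans (ler_sum _ term) _.
  rewrite 2!big_split /= sumr_const -[P * s *+ _]mulr_natr -mulr_sumr.
  apply: lerD; last by rewrite ler_wpM2l.
  rewrite lerD2l sumrN lerN2 -mulr_suml -natr_sum.
  apply: ler_wpM2r => //; rewrite ler_nat -sum1_card big_mkcond /=.
  rewrite [leqRHS]big_mkcond /=; apply: leq_sum => y _.
  by rewrite in_setD; case: (y \in Y); case: (y \in W).
have Q_ge0 := ler0n R #|Q|; have D_ge0 := ler0n R #|D|.
have mK : m * (1 + Kr) <= 1 / 4 by rewrite /m; move: om_le; lra.
have QD_ge0 : 0 <= card Q + card D by rewrite addr_ge0.
(* Each vertex of [Q] or [D] costs at least [s], hence at least 1/2, and brings back at most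
   [m * (1 + Kr)], hence at most 1/4. *)
have key : lam ^+ 2 * s <= P * (nR - P) * s - (card Q + card D) / 4.
  have mQD := ler_wpM2r QD_ge0 mK.
  have mD : 0 <= m * card D by rewrite mulr_ge0.
  have sQD := ler_wpM2r QD_ge0 s_ge.
  have PsQ : s * card Q <= P * (s * card Q) by rewrite ler_peMl // mulr_ge0.
  by move: total mQD mD sQD PsQ; rewrite cardY; lra.
have lam_s := ler_wpM2r s_ge0 lam_ge.
have Q0 : card Q = 0 by lra.
have D0 : card D = 0 by lra.
have s_gt0 : 0 < s by lra.
split.
  apply/le_anti; rewrite lam_ge andbT -(ler_pM2r s_gt0).
  by move: key; rewrite Q0 D0; lra.
have cardWT : #|~: W| = p.
  by apply/eqP; rewrite -(eqr_nat R) cardCW Q0 D0 !add0r.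
apply: setC_inj; rewrite setCK; apply/esym/eqP.
rewrite eqEcard cardWT cardT leqnn andbT.
apply/subsetP => t tT; rewrite in_setC; apply/negP => /(subsetP sWY).
exact/negP/TX.
Qed.

(** Here [d] measures how close [g] is to 1 on the core, [e] is the level whose set has at most [s0]
    vertices, [eta] is the lower level used to bound degrees, and [x] is a lower bound for [lam]. *)
Lemma subsolution_rigidity (u : G) (d e eta x : R) (s0 : nat) :
  g u = 1 -> 0 < d -> 0 < e -> 0 < eta -> 0 <= x ->
  32 * P * (P + 2 * Kr) * (1 + Kr) * d <= 1 -> 4 * Kr * e <= d ->
  8 * (eta * Kr) <= e -> 4 * Kr ^+ 2 <= e * s0%:R -> 8 * Kr ^+ 2 <= e * eta * x ->
  4 * P + 4 <= nR -> 2 * x ^+ 2 <= nR ->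
  2 * (P ^+ 2 + (2 ^ s0 * (2 * p.+1) * s0)%N%:R + 1) <= d * nR ->
  P * (nR - P) <= lam ^+ 2 ->
  lam ^+ 2 = P * (nR - P) /\ exists2 T : {set G}, #|T| = p & cnbr T = ~: T.
Proof.
set b := (_ * s0)%N%:R.
move=> gu d_gt0 e_gt0 eta_gt0 x_ge0 d_le e_le eta_le s0_ge x_ge n1 n2 n3 lam_ge.
have P_ge1 : 1 <= P by rewrite ler1n.
have K_ge1 : 1 <= Kr by rewrite ler1n.
have n_gt0 : 0 < nR by lra.
have Pn_le : P * nR <= 2 * lam ^+ 2.
  have n2P : 2 * P <= nR by lra.
  by have := ler_wpM2l (ler0n R p) n2P; move: lam_ge; lra.
have n_le : nR <= 2 * lam ^+ 2.
  by apply: le_trans Pn_le; rewrite ler_peMl // ltW.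
have x_lam : x <= lam.
  by rewrite -ler_sqr ?nnegrE ?(ltW lam_gt0) //; move: n2 n_le; lra.
(* 192 is 32 times 3 times 2, from [P >= 1] and [Kr >= 1]. *)
have d_small : 192 * d <= 1.
  apply: le_trans d_le; rewrite ler_wpM2r ?(ltW d_gt0) //.
  have q3 : 3 <= P + 2 * Kr by lra.
  have q2 : 2 <= 1 + Kr by lra.
  have r1 : 3 * 2 <= (P + 2 * Kr) * (1 + Kr) by apply: ler_pM.
  have r2 : (P + 2 * Kr) * (1 + Kr) <= P * ((P + 2 * Kr) * (1 + Kr)).
    by rewrite ler_peMl //; lra.
  by move: r1 r2; lra.
have levelK : 8 * (Kr * card (level eta)) <= e * nR.
  have le_gt0 : 0 < lam * eta by rewrite mulr_gt0.
  rewrite -(ler_pM2l le_gt0).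
  have := ler_wpM2l (ler0n R K) (level_card eta).
  have ee_ge0 : 0 <= e * eta by rewrite mulr_ge0 ?ltW.
  have := ler_wpM2l ee_ge0 x_lam => /(le_trans x_ge)/(ler_wpM2r (ltW n_gt0)).
  by lra.
have level_le : (#|level e| <= s0)%N.
  rewrite -(ler_nat R) -(ler_pM2l e_gt0); apply: le_trans s0_ge.
  apply: level_card_bound => //; first by rewrite -(ltr0n R).
  by move=> v; apply: level_deg levelK.
have bP : card (rich (level e)) * card (level e) <= b.
  rewrite -natrM ler_nat leq_mul //; apply: leq_trans (rich_card _) _.
  by rewrite leq_mul2r leq_exp2l // level_le orbT.
have eKn : 4 * (e * (Kr * nR)) <= d * nR.
  by have := ler_wpM2r (ltW n_gt0) e_le; lra.
have dn_ge0 : 0 <= d * nR by rewrite mulr_ge0 ?ltW.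
have [||y [T [sT cardT gT]]] :=
  exists_core (ltW e_gt0) d_gt0 _ gu lam_ge bP _; [lra|lra|].
have b_ge0 : 0 <= b by [].
have P2_ge0 : 0 <= P ^+ 2 by rewrite sqr_ge0.
have Pdn : d * nR <= P * (d * nR) by rewrite ler_peMl.
have degT t : t \in T -> nR - card (nbr t) <= 4 * (d * nR).
  have P_gt0 : 0 < P by lra.
  move=> /gT gt; rewrite -(ler_pM2l P_gt0); have := walks_level_deg t (ltW e_gt0) bP.
  have := ler_wpM2l (sqr_ge0 lam) gt.
  have d1 : 0 <= 1 - d by lra.
  have := ler_wpM2r d1 lam_ge.
  have P2d : 0 <= P ^+ 2 * d by rewrite mulr_ge0 // ltW.
  by lra.
have cardW : card (~: cnbr T) <= 4 * P * d * nR.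
  apply: le_trans (cnbr_card _ degT) _; first by lra.
  by rewrite cardT; lra.
have Pd_le : 8 * (4 * P * d) <= 1.
  apply: le_trans d_le.
  rewrite -[leRHS]mulrA -[leRHS]mulrA -[leRHS]mulrA.
  have q1 : 1 <= (P + 2 * Kr) * (1 + Kr).
    by rewrite -[leLHS]mulr1; apply: ler_pM => //; lra.
  have Pd_ge0 : 0 <= P * d by rewrite mulr_ge0 // ltW.
  by have := ler_wpM2l Pd_ge0 q1; lra.
(* Each of the [p] vertices of [T] misses at most [4 * (d * nR)] vertices, whence
   [om = 4 * P * d]. *)
have [|||-> WT] := @core_rigidity T y (4 * P * d) sT cardT _ cardW _ Pn_le _ lam_ge.
- have : \sum_(t in T) (1 - d) <= \sum_(t in T) g t by apply: ler_sum.
  rewrite sumr_const cardT -mulr_natl.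
  have d1 : 0 <= 1 - d by lra.
  by have := ler_wpM2r d1 P_ge1; lra.
- rewrite -(ler_nat R) natrM -natr1.
  have : nR = card (cnbr T) + card (~: cnbr T) by rewrite -natrD cardsC.
  by have := ler_wpM2r (ltW n_gt0) Pd_le; move: cardW; lra.
- by move: d_le; lra.
by split=> //; exists T.
Qed.

End Subsolution.

(** * Eigenvalues *)

Lemma eigenvalue_subsolution (R : realType) (G : sgraph) (lam : R) :
  0 <= lam -> eigenvalue (adjacency_mx R G) lam ->
  exists g : G -> R, exists u : G,
    [/\ forall v, 0 <= g v, forall v, g v <= 1, g u = 1 &
        forall v, lam * g v <= \sum_(w in nbr v) g w].
Proof.
move=> lam_ge0 /eigenvalueP[a aA a_neq0].
pose f (v : G) := `|a 0 (enum_rank v)|.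
have [i ai] : exists i, a 0 i != 0.
  apply/existsP; rewrite -[X in is_true X]negbK negb_exists.
  apply: contraNN a_neq0 => /forallP a0.
  by apply/eqP/rowP => i; rewrite mxE; apply/eqP; have := a0 i; rewrite negbK.
pose u := [arg max_(v > enum_val i) f v]%O.
have u_max v : f v <= f u.
  by rewrite /u; case: arg_maxP => // u' _; apply.
have u_gt0 : 0 < f u.
  by apply: lt_le_trans (u_max (enum_val i)); rewrite /f enum_valK normr_gt0.
exists (fun v => f v / f u), u; split.
- by move=> v; rewrite divr_ge0 ?normr_ge0.
- by move=> v; rewrite ler_pdivrMr // mul1r.
- by rewrite divff // gt_eqF.
move=> v; rewrite -mulr_suml mulrA ler_wpM2r ?invr_ge0 ?(ltW u_gt0) //.
have -> : lam * f v = `|\sum_(w in nbr v) a 0 (enum_rank w)|.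
  rewrite /f -{1}(ger0_norm lam_ge0) -normrM; congr `|_|.
  have := congr1 (fun m : 'rV_#|G| => m 0 (enum_rank v)) aA; rewrite !mxE => <-.
  rewrite (reindex _ (onW_bij _ (@enum_rank_bij G))) /= [RHS]big_mkcond /=.
  apply: eq_bigr => w _; rewrite mxE !enum_rankK inE adj_sym.
  by case: adj; rewrite ?mulr1 ?mulr0.
exact: ler_norm_sum.
Qed.

(** The eigenvector is sqrt b on the part of size [a] and sqrt a on the other: a vertex of the first
    part sums [b] copies of sqrt a, which is sqrt(ab) times sqrt b. *)
Lemma complete_bipartite_eigenvalue (R : realType) (G : sgraph) (a b : nat) :
  (0 < #|G|)%N -> (0 < a)%N -> (0 < b)%N ->
  isomorphic G (complete_bipartite a b) ->
  eigenvalue (adjacency_mx R G) (Num.sqrt (a * b)%N%:R).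
Proof.
move=> G_gt0 a_gt0 b_gt0 [f [[f' fK f'K] f_adj]]; apply/eigenvalueP.
pose h (x : 'I_a + 'I_b) : R :=
  if x is inl _ then Num.sqrt b%:R else Num.sqrt a%:R.
have h_gt0 x : 0 < h x by case: x => x; rewrite sqrtr_gt0 ltr0n.
exists (\row_i h (f (enum_val i))); last first.
  have [v _] := card_gt0P G_gt0; apply/negP => /eqP/rowP/(_ (enum_rank v)).
  by rewrite !mxE => h0; have := h_gt0 (f (enum_val (enum_rank v))); rewrite h0 ltxx.
apply/rowP => j; rewrite !mxE (reindex _ (onW_bij _ (@enum_rank_bij G))) /=.
rewrite (reindex f') /=; last by exists f => x _.
under eq_bigr => x _.
  rewrite !mxE enum_rankK -f_adj f'K; over.
rewrite big_sumType /= natrM sqrtrM ?ler0n //.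
case: (f _) => x /=.
  rewrite big1 ?add0r => [|i _]; last by rewrite mulr0.
  rewrite (eq_bigr (fun=> Num.sqrt a%:R)) => [|i _]; last by rewrite mulr1.
  by rewrite sumr_const card_ord -[Num.sqrt _ *+ _]mulr_natr -mulrA -expr2 sqr_sqrtr.
rewrite [X in _ + X]big1 ?addr0 => [|i _]; last by rewrite mulr0.
rewrite (eq_bigr (fun=> Num.sqrt b%:R)) => [|i _]; last by rewrite mulr1.
by rewrite sumr_const card_ord -[Num.sqrt _ *+ _]mulr_natr mulrAC -expr2 sqr_sqrtr // mulrC.
Qed.

(** All edges across are present by hypothesis; two vertices on one side share a neighbour across,
    so the colouring forbids an edge between them. *)
Lemma cnbr_setC_isomorphic (G : sgraph) (c : G -> bool) (p : nat) (T : {set G}) :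
  (forall x y : G, adj x y -> c x != c y) -> (0 < p < #|G|)%N -> #|T| = p ->
  cnbr T = ~: T -> isomorphic G (complete_bipartite p (#|G| - p)).
Proof.
move=> cP /andP[p_gt0 p_lt] cardT WT.
have cardW : #|~: T| = (#|G| - p)%N by rewrite cardsCs setCK cardT.
have /card_gt0P[t0 t0T] : (0 < #|T|)%N by rewrite cardT.
have /card_gt0P[w0 w0W] : (0 < #|~: T|)%N by rewrite cardW subn_gt0.
have TW t w : t \in T -> w \in ~: T -> adj t w.
  by rewrite -WT inE => tT /subsetP/(_ _ tT); rewrite inE adj_sym.
have indep (x y z : G) : adj x y -> adj x z -> adj y z = false.
  move=> /cP xy /cP xz; apply/negP => /cP.
  by move: xy xz; case: (c x); case: (c y); case: (c z).
pose f (x : G) : complete_bipartite p (#|G| - p) :=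
  if x \in T then inl (cast_ord cardT (enum_rank_in t0T x))
  else inr (cast_ord cardW (enum_rank_in w0W x)).
have f_inj : injective f.
  move=> x y; rewrite /f; case: ifP => xT; case: ifP => yT //.
    move=> /(congr1 (fun z => if z is inl i then val i else 0%N)) /= e.
    by apply: (enum_rank_in_inj (Ax0 := t0T) (Ay0 := t0T) xT yT); apply: val_inj.
  move=> /(congr1 (fun z => if z is inr i then val i else 0%N)) /= e.
  have [xW yW] : x \in ~: T /\ y \in ~: T by rewrite !inE xT yT.
  by apply: (enum_rank_in_inj (Ax0 := w0W) (Ay0 := w0W) xW yW); apply: val_inj.
exists f; split.
  apply: inj_card_bij => //.
  by rewrite /complete_bipartite /= card_sum !card_ord subnKC // ltnW.
move=> x y; rewrite /f /=; case: ifP => xT; case: ifP => yT /=.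
- by rewrite (@indep w0) // adj_sym TW.
- by rewrite TW // inE yT.
- by rewrite adj_sym TW // inE xT.
- by rewrite (@indep t0) // TW // inE ?xT ?yT.
Qed.

(** * Constants, threshold and conclusion *)

Lemma nat_above (R : realType) (y : R) : exists m : nat, y <= m%:R.
Proof.
have [y_le0|/ltW y_ge0] := leP y 0; first by exists 0%N.
by exists (Num.truncn y).+1; apply/ltW/truncnS_gt.
Qed.

(** Chosen in the order [d], [e], [eta], then [s0] and [x], each from the earlier ones. Only [P] and
    [K] enter, so the threshold will depend on [p] alone. *)
Lemma rigidity_constants (R : realType) (P K : R) : 0 < P -> 0 < K ->
  exists (d e eta x : R) (s0 : nat),
    [/\ [/\ 0 < d, 0 < e, 0 < eta & 0 <= x],
        32 * P * (P + 2 * K) * (1 + K) * d <= 1 /\ 4 * K * e <= d,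
        8 * (eta * K) <= e,
        4 * K ^+ 2 <= e * s0%:R & 8 * K ^+ 2 <= e * eta * x].
Proof.
move=> P_gt0 K_gt0.
have d_inv : 0 < 32 * P * (P + 2 * K) * (1 + K).
  by rewrite !mulr_gt0 ?addr_gt0 ?mulr_gt0.
have [d d_gt0 dE] : exists2 d, 0 < d & 32 * P * (P + 2 * K) * (1 + K) * d <= 1.
  by exists (32 * P * (P + 2 * K) * (1 + K))^-1; rewrite ?invr_gt0 // mulfV ?gt_eqF.
have K4 : 0 < 4 * K by rewrite mulr_gt0.
have [e e_gt0 eE] : exists2 e, 0 < e & 4 * K * e <= d.
  by exists (d / (4 * K)); rewrite ?divr_gt0 // mulrC divfK ?gt_eqF.
have K8 : 0 < 8 * K by rewrite mulr_gt0.
have [eta eta_gt0 etaE] : exists2 eta, 0 < eta & 8 * (eta * K) <= e.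
  exists (e / (8 * K)); rewrite ?divr_gt0 //.
  by rewrite mulrCA divfK ?gt_eqF.
have [s0 s0E] := nat_above (4 * K ^+ 2 / e).
have ee_gt0 : 0 < e * eta by rewrite mulr_gt0.
exists d, e, eta, (8 * K ^+ 2 / (e * eta)), s0; split=> //.
- by split=> //; rewrite divr_ge0 ?(ltW ee_gt0) // mulr_ge0 ?sqr_ge0.
- by rewrite [leRHS]mulrC -ler_pdivrMr.
- by rewrite [leRHS]mulrC divfK ?gt_eqF.
Qed.

Lemma free_eigenvalue_rigidity (R : realType) (p : nat) : (1 <= p)%N ->
  exists N : nat, forall (l : nat) (k : 'I_l -> nat) (G : sgraph) (lam : R),
    (forall i : 'I_l, (2 <= k i)%N) -> (\sum_(i < l) k i %/ 2 = p.+1)%N ->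
    (N <= #|G|)%N -> bipartite G -> free_of (linear_forest k) G ->
    eigenvalue (adjacency_mx R G) lam -> 0 <= lam ->
    (p * (#|G| - p))%N%:R <= lam ^+ 2 ->
    lam ^+ 2 = (p * (#|G| - p))%N%:R /\
    isomorphic G (complete_bipartite p (#|G| - p)).
Proof.
move=> p_gt0; have P_gt0 : 0 < p%:R :> R by rewrite ltr0n.
(* The edge bound has constant [6 * p.+1]; doubling it also covers [#|A| + #|B| <= 2 * #|G|]. *)
have [K KE] : exists K, K = (12 * p.+1)%N by exists (12 * p.+1)%N.
have K_gt0 : (0 < K)%N by rewrite KE.
have Kr_gt0 : 0 < K%:R :> R by rewrite ltr0n.
have [d [e [eta [x [s0 [[d0 e0 eta0 x0] [dE eE] etaE s0E xE]]]]]] :=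
  rigidity_constants P_gt0 Kr_gt0.
have [N1 N1E] := nat_above (2 * x ^+ 2).
have [N2 N2E] := nat_above
  (2 * (p%:R ^+ 2 + (2 ^ s0 * (2 * p.+1) * s0)%N%:R + 1) / d).
exists (4 * p + 4 + N1 + N2)%N.
move=> l k G lam k2 sum_k n_large [c cP] freeG eig lam_ge0 lam_ge.
have [g [u [g_ge0 g_le1 gu g_sub]]] := eigenvalue_subsolution lam_ge0 eig.
have [n1 n2 n3 p_lt] : [/\ 4 * p + 4 <= #|G|, N1 <= #|G|, N2 <= #|G| & p < #|G|]%N.
  by move: n_large; clear; split; lia.
have lamE : (p * (#|G| - p))%N%:R = p%:R * (#|G|%:R - p%:R) :> R.
  by rewrite natrM natrB // ltnW.
have lam_gt0 : 0 < lam.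
  rewrite lt0r lam_ge0 andbT; apply/eqP => lam0; move: lam_ge.
  by rewrite lam0 expr0n /= leNgt ltr0n muln_gt0 p_gt0 subn_gt0 p_lt.
have edges_half := free_edges_le k2 sum_k freeG.
have e1 A B : (@edges G A B <= K * (#|A| + #|B|))%N.
  apply: leq_trans (edges_half A B) _.
  by rewrite leq_mul2r KE leq_mul2r orbT.
have e2 A B : (@edges G A B <= K * #|G|)%N.
  apply: leq_trans (edges_half A B) _.
  have : (#|A| + #|B| <= 2 * #|G|)%N by rewrite mul2n -addnn leq_add ?max_card.
  by rewrite KE; clear; nia.
have m1 : 4 * p%:R + 4 <= #|G|%:R :> R by rewrite -natrM -natrD ler_nat.
have m2 : 2 * x ^+ 2 <= #|G|%:R by apply: le_trans N1E _; rewrite ler_nat.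
have m3 : 2 * (p%:R ^+ 2 + (2 ^ s0 * (2 * p.+1) * s0)%N%:R + 1) <= d * #|G|%:R.
  by rewrite [leRHS]mulrC -ler_pdivrMr //; apply: le_trans N2E _; rewrite ler_nat.
rewrite lamE in lam_ge *.
have [-> [T cardT WT]] := subsolution_rigidity cP p_gt0 K_gt0 e1 e2
  (free_cnbr k2 sum_k freeG) lam_gt0 g_ge0 g_le1 g_sub gu
  d0 e0 eta0 x0 dE eE etaE s0E xE m1 m2 m3 lam_ge.
by split=> //; apply: cnbr_setC_isomorphic cP _ cardT WT; rewrite p_gt0.
Qed.

Theorem theorem1p6 (R : realType) (p : nat) (p_ge1 : (1 <= p)%N) :
  exists N : nat,
    forall (l : nat) (k : 'I_l -> nat),
      (1 <= l)%N ->
      (forall i j : 'I_l, (i <= j)%N -> (k j <= k i)%N) ->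
      (forall i : 'I_l, (2 <= k i)%N) ->
      p = (\sum_(i < l) (k i %/ 2) - 1)%N ->
      forall (n : nat) (G : sgraph),
        (N <= n)%N ->
        #|G| = n ->
        bipartite G ->
        free_of (linear_forest k) G ->
        spectral_radius R G <= Num.sqrt (p * (n - p))%N%:R /\
        (spectral_radius R G = Num.sqrt (p * (n - p))%N%:R <->
         isomorphic G (complete_bipartite p (n - p))).
Proof.
have [N rigid] := free_eigenvalue_rigidity R p_ge1.
exists (N + p.+1)%N => l k _ _ k2 pE n G n_large cardG bipG freeG.
(* As [p >= 1], the truncated subtraction in [pE] is a true one. *)
have sum_k : (\sum_(i < l) k i %/ 2 = p.+1)%N by move: pE p_ge1; lia.
have n_lt : (p < n)%N by lia.
have G_gt0 : (0 < #|G|)%N by rewrite cardG; lia.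
have [eig eig_max] := spectral_radius_max R G_gt0.
set lam := spectral_radius R G in eig eig_max *.
set q : R := (p * (n - p))%N%:R.
have q_ge0 : 0 <= q by [].
have above : Num.sqrt q <= lam ->
    lam ^+ 2 = q /\ isomorphic G (complete_bipartite p (n - p)).
  move=> le_lam; have lam_ge0 : 0 <= lam by apply: le_trans le_lam; apply: sqrtr_ge0.
  rewrite -cardG /q -cardG; apply: (rigid _ _ _ _ k2 sum_k _ bipG freeG eig lam_ge0).
    by rewrite cardG; lia.
  have sq : Num.sqrt q ^+ 2 <= lam ^+ 2 by rewrite ler_sqr ?nnegrE ?sqrtr_ge0.
  by rewrite sqr_sqrtr // in sq; rewrite cardG.
(* A strict excess would fall under [above], which returns equality. *)
have upper : lam <= Num.sqrt q.
  rewrite leNgt; apply/negP => lt_lam.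
  have [lamE _] := above (ltW lt_lam); move: lt_lam.
  by rewrite -lamE sqrtr_sqr ltNge ler_norm.
split=> //; split=> [lamE|iso]; first by have [] := above; rewrite ?lamE.
apply: le_anti; rewrite upper /=; apply: eig_max.
by apply: complete_bipartite_eigenvalue => //; rewrite subn_gt0.
Qed.
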